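(* Let $q$ be a complex number with $q\neq 0,1$ and let $m,r,x$ be complex numbers. For every non-negative integer $n$, the $(q,r)$-Dowling polynomials satisfy $$D_{m,r,q}(n,x)=\sum_{k=0}^n\binom{n}{k}r^{n-k}\sum_{j=0}^k m^{k-j}\,S_q(k,j)\,x^j.$$
   Context: $[\ell]_q=\frac{q^\ell-1}{q-1}$. The $(q,r)$-Whitney numbers of the second kind $W_{m,r,q}(n,k)$ are defined by $(ma^\dagger a+r)^n=\sum_{k=0}^{n}m^kW_{m,r,q}(n,k)(a^\dagger)^k a^k$ with $q$-boson operators $aa^\dagger-qa^\dagger a=1$; equivalently $W_{m,r,q}(0,0)=1$, $W_{m,r,q}(n,k)=0$ for $k<0$ or $k>n$, and $W_{m,r,q}(n+1,k)=q^{k-1}W_{m,r,q}(n,k-1)+(m[k]_q+r)W_{m,r,q}(n,k)$. The $(q,r)$-Dowling polynomials are $D_{m,r,q}(n,x)=\sum_{k=0}^nW_{m,r,q}(n,k)x^k$. The $q$-Stirling numbers of the second kind $S_q(n,k)$ are defined by $[x]_q^n=\sum_{k=0}^n S_q(n,k)[x]_q[x-1]_q\cdots[x-k+1]_q$; equivalently $S_q(n,k)=W_{1,0,q}(n,k)$, i.e. $S_q(0,0)=1$, $S_q(n,k)=0$ for $k<0$ or $k>n$, and $S_q(n+1,k)=q^{k-1}S_q(n,k-1)+[k]_qS_q(n,k)$. *)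

(* Defs.v *)
From HB Require Import structures.
From mathcomp Require Import all_boot all_order all_algebra.
From mathcomp Require Import ring.
From mathcomp Require Export reals complex.

Set Implicit Arguments.
Unset Strict Implicit.
Unset Printing Implicit Defensive.

Import GRing.Theory.
Local Open Scope ring_scope.

Section QNumbers.
Variable F : fieldType.
Implicit Types (q m r x : F) (n k l : nat).

Definition qnum q l : F := (q ^+ l - 1) / (q - 1).

(* The convention W(n, k) = 0 for k < 0 is encoded by the absence of the term
   W(n, k - 1) in the case k = 0; W(n, k) = 0 for k > n follows from
   W(0, k) = 0 for k > 0 (qrWhitney_gt). *)
Fixpoint qrWhitney m r q n k : F :=
  match n, k with
  | 0, 0 => 1
  | 0, _.+1 => 0
  | n'.+1, 0 => (m * qnum q 0 + r) * qrWhitney m r q n' 0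
  | n'.+1, k'.+1 => q ^+ k' * qrWhitney m r q n' k'
                    + (m * qnum q k'.+1 + r) * qrWhitney m r q n' k'.+1
  end.

Fixpoint qStirling2 q n k : F :=
  match n, k with
  | 0, 0 => 1
  | 0, _.+1 => 0
  | n'.+1, 0 => qnum q 0 * qStirling2 q n' 0
  | n'.+1, k'.+1 => q ^+ k' * qStirling2 q n' k'
                    + qnum q k'.+1 * qStirling2 q n' k'.+1
  end.

Definition qrDowling m r q n x : F :=
  \sum_(k < n.+1) qrWhitney m r q n k * x ^+ k.

Lemma qrWhitney_gt m r q n k : (n < k)%N -> qrWhitney m r q n k = 0.
Proof.
elim: n k => [|n IHn] [|k] //= ltnk.
by rewrite !IHn ?mulr0 ?addr0 // ltnW.
Qed.

Lemma qStirling2E q n k : qStirling2 q n k = qrWhitney 1 0 q n k.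
Proof. by elim: n k => [|n IHn] [|k] //=; rewrite !IHn !mul1r !addr0. Qed.

Lemma qnumS q l : q != 1 -> qnum q l.+1 = qnum q l + q ^+ l.
Proof. by move=> q1; rewrite /qnum exprS; field; rewrite subr_eq0. Qed.

Lemma qnum_sub q l k : q != 1 -> (k <= l)%N ->
  qnum q l = qnum q k + q ^+ k * qnum q (l - k).
Proof.
move=> q1 lekl; rewrite /qnum -{1}(subnKC lekl) exprD.
by field; rewrite subr_eq0.
Qed.

Lemma qboson_number_shift (A : algType F) (a ad : A) q k :
  q != 1 -> a * ad - q *: (ad * a) = 1 ->
  ad * a * ad ^+ k = qnum q k *: ad ^+ k + q ^+ k *: (ad ^+ k.+1 * a).
Proof.
move=> q1 /eqP; rewrite subr_eq => /eqP aad.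
elim: k => [|k IHk].
  by rewrite /qnum !expr0 subrr mul0r scale0r add0r mulr1 scale1r expr1.
rewrite exprSr mulrA IHk mulrDl -!scalerAl -exprSr -mulrA aad mulrDr mulr1.
rewrite -scalerAr mulrA -exprSr scalerDr scalerA -exprSr addrA -scalerDl.
by rewrite -qnumS.
Qed.

(* Normal ordering: the coefficients of the q-boson expansion satisfy the
   recurrence used as definition of qrWhitney. *)
Lemma qrWhitney_normal_ordering (A : algType F) (a ad : A) m r q n :
  q != 1 -> a * ad - q *: (ad * a) = 1 ->
  (m *: (ad * a) + r%:A) ^+ n =
    \sum_(k < n.+1) (m ^+ k * qrWhitney m r q n k) *: (ad ^+ k * a ^+ k).
Proof.
move=> q1 aad; elim: n => [|n IHn].
  by rewrite big_ord1 !expr0 !mulr1 scale1r.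
have step k : (m *: (ad * a) + r%:A) * (ad ^+ k * a ^+ k) =
    (m * qnum q k + r) *: (ad ^+ k * a ^+ k)
    + (m * q ^+ k) *: (ad ^+ k.+1 * a ^+ k.+1).
  rewrite mulrDl -!scalerAl mul1r mulrA (qboson_number_shift k q1 aad).
  rewrite mulrDl -!scalerAl -mulrA -exprS scalerDr !scalerA addrAC.
  by rewrite -scalerDl.
rewrite exprS IHn mulr_sumr.
under eq_bigr => k _ do rewrite -scalerAr step scalerDr !scalerA.
rewrite [LHS]big_split /= [RHS]big_ord_recl [X in X + _ = _]big_ord_recl /=.
under [X in _ = _ + X]eq_bigr => k _ do
  rewrite /bump /= add1n mulrDr scalerDl.
rewrite big_split /= -addrA; congr (_ *: _ + _); first by ring.
rewrite addrC; congr (_ + _).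
  by apply: eq_bigr => k _; congr (_ *: _); rewrite exprS; ring.
rewrite big_ord_recr /= (@qrWhitney_gt m r q n n.+1) // !mulr0 scale0r addr0.
by apply: eq_bigr => k _; congr (_ *: _); rewrite /bump /= add1n; ring.
Qed.

(* The subtraction l - i is truncated, but the product vanishes as soon as
   k > l since it then contains the factor qnum q 0 = 0. *)
Lemma qStirling2_expansion q n l : q != 1 ->
  qnum q l ^+ n =
    \sum_(k < n.+1) qStirling2 q n k * \prod_(i < k) qnum q (l - i).
Proof.
move=> q1; elim: n => [|n IHn].
  by rewrite big_ord1 big_ord0 mulr1.
have gt0 k : (n < k)%N -> qStirling2 q n k = 0.
  by move=> ltnk; rewrite qStirling2E qrWhitney_gt.
have step k : qnum q l * \prod_(i < k) qnum q (l - i) =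
    qnum q k * \prod_(i < k) qnum q (l - i)
    + q ^+ k * \prod_(i < k.+1) qnum q (l - i).
  rewrite [in X in _ + X]big_ord_recr /=.
  case: (leqP k l) => [lekl|ltlk]; first by rewrite (qnum_sub q1 lekl); ring.
  rewrite (bigD1 (Ordinal ltlk)) //= subnn /qnum expr0 subrr mul0r.
  by rewrite !mul0r !mulr0 addr0.
rewrite exprS IHn mulr_sumr.
under eq_bigr => k _ do rewrite mulrCA step mulrDr.
rewrite [LHS]big_split /= [RHS]big_ord_recl [X in X + _ = _]big_ord_recl /=.
under [X in _ = _ + X]eq_bigr => k _ do
  rewrite /bump /= add1n mulrDl.
rewrite [X in _ = _ + X]big_split /= -addrA; congr (_ + _); first by ring.
rewrite addrC; congr (_ + _).
  by apply: eq_bigr => k _; ring.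
rewrite big_ord_recr /= gt0 // mulr0 mul0r addr0.
by apply: eq_bigr => k _; rewrite /bump /= add1n; ring.
Qed.

End QNumbers.

(* Main.v *)
(** Write T(n, j) for the numbers with r = 0. Their recurrence T(n+1, j) =
    q^(j-1) T(n, j-1) + m [j]_q T(n, j) is that of m^(n-j) S_q(n, j). Adding r
    turns the one-step operator L of this recurrence into L + r, and r commutes
    with L, so the Whitney numbers are the binomial transform of T. *)
Require Import Defs.
From mathcomp Require Import all_boot all_order all_algebra.
From mathcomp Require Import reals complex.
From mathcomp Require Import ring.
Import GRing.Theory.
Local Open Scope ring_scope.

(** Pascal's rule: the ['C(n, k)] part yields the factor [r], the other part shifts [f]. *)
Lemma binomial_transformS (A : comNzRingType) (r : A) (f : nat -> A) (n : nat) :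
  \sum_(k < n.+2) 'C(n.+1, k)%:R * r ^+ (n.+1 - k) * f k =
  r * (\sum_(k < n.+1) 'C(n, k)%:R * r ^+ (n - k) * f k)
  + \sum_(k < n.+1) 'C(n, k)%:R * r ^+ (n - k) * f k.+1.
Proof.
have -> : r * (\sum_(k < n.+1) 'C(n, k)%:R * r ^+ (n - k) * f k) =
    \sum_(k < n.+2) 'C(n, k)%:R * r ^+ (n.+1 - k) * f k.
  rewrite [RHS]big_ord_recr /= bin_small // !mul0r addr0 mulr_sumr.
  by apply: eq_bigr => k _; rewrite (subSn (leq_ord k)) exprS; ring.
rewrite big_ord_recl [in RHS]big_ord_recl /= !bin0 -addrA; congr (_ + _).
rewrite -big_split /=; apply: eq_bigr => k _.
by rewrite /bump /= add1n subSS binS natrD; ring.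
Qed.

Section WhitneyStirling.
Variables (F : fieldType) (m r q : F).

Lemma qrWhitney_r0 (n k : nat) :
  qrWhitney m 0 q n k = m ^+ (n - k) * qStirling2 q n k.
Proof.
elim: n k => [|n IHn] [|k] /=; rewrite ?mulr1 ?mulr0 //.
  by rewrite IHn !subn0 exprS; ring.
(* For [k < n] the factor [m] raises the exponent [n - k.+1] to [n - k]. For [n <= k] the
   subtraction truncates, but S_q(n, k+1) = 0. *)
rewrite !IHn subSS addr0; case: (ltnP k n) => [ltkn|lenk].
  by rewrite -(subnSK ltkn) exprS; ring.
by rewrite (qStirling2E q n k.+1) qrWhitney_gt //; ring.
Qed.

Lemma qrWhitney_binomial (n j : nat) :
  qrWhitney m r q n j =
  \sum_(k < n.+1) 'C(n, k)%:R * r ^+ (n - k) * qrWhitney m 0 q k j.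
Proof.
elim: n j => [|n IHn] j; first by rewrite big_ord1 !mul1r; case: j.
rewrite (binomial_transformS _ r (fun k => qrWhitney m 0 q k j)) -IHn.
(* The recurrence coefficients depend only on the column, so they leave the sum over [k]. *)
have scale c i :
    \sum_(k < n.+1) 'C(n, k)%:R * r ^+ (n - k) * (c * qrWhitney m 0 q k i) =
    c * qrWhitney m r q n i.
  by rewrite IHn mulr_sumr; apply: eq_bigr => k _; rewrite mulrCA.
case: j => [|j] /=; first by rewrite scale addr0 addrC mulrDl.
under [X in _ = _ + X]eq_bigr => k _ do rewrite mulrDr.
by rewrite big_split /= !scale addr0 mulrDl [RHS]addrC -addrA.
Qed.

End WhitneyStirling.

Theorem theorem14 (R : realType) (q m r x : R[i])
    (q_neq0 : q != 0) (q_neq1 : q != 1) (n : nat) :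
  qrDowling m r q n x =
    \sum_(k < n.+1) 'C(n, k)%:R * r ^+ (n - k) *
      \sum_(j < k.+1) m ^+ (k - j) * qStirling2 q k j * x ^+ j.
Proof.
rewrite /qrDowling.
under eq_bigr => j _ do rewrite qrWhitney_binomial mulr_suml.
rewrite exchange_big /=; apply: eq_bigr => k _.
under eq_bigr => j _ do rewrite -mulrA.
rewrite -mulr_sumr; congr (_ * _).
(* Both sums now run over [j <= n]; on the left the terms with [j > k] vanish. *)
rewrite (big_ord_widen n.+1 (fun j => m ^+ (k - j) * qStirling2 q k j * x ^+ j)) //.
rewrite [RHS]big_mkcond /=; apply: eq_bigr => j _.
rewrite ltnS; case: leqP => [_|ltkj]; first by rewrite qrWhitney_r0.
by rewrite qrWhitney_gt ?mul0r.
Qed.
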